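(* Assume a measurement matrix $\Phi$ satisfies the Restricted Isometry Condition with parameters $(8n,\varepsilon)$ for $\varepsilon=0.01/\sqrt{\log n}$. Consider an arbitrary vector $v$ in $\mathbb{R}^d$. Suppose that the measurement vector $\Phi v$ becomes corrupted, so we consider $x=\Phi v+e$ where $e$ is some error vector. Then ROMP produces a good approximation to $v_{2n}$: its reconstructed vector $\hat v$ satisfies $$\|\hat v-v_{2n}\|_2\le 159\sqrt{\log 2n}\,\Big(\|e\|_2+\frac{\|v-v_n\|_1}{\sqrt n}\Big).$$
   Context: The measurement matrix $\Phi$ is an $N\times d$ real matrix (with $N\ll d$), $e\in\mathbb{R}^N$, and $n$ is a positive integer. For a vector $f$, $f_m$ denotes the vector of the $m$ biggest coefficients in absolute value of $f$ (the other coordinates being zero). A vector is $m$-sparse if it has at most $m$ nonzero coordinates. For an index set $I\subset\{1,\dots,d\}$, $u|_I$ denotes the restriction of $u$ to the coordinates in $I$, and $\mathbb{R}^I$ is identified with the vectors of $\mathbb{R}^d$ supported in $I$. Restricted Isometry Condition (RIC): a measurement matrix $\Phi$ satisfies the RIC with parameters $(m,\varepsilon)$ for $\varepsilon\in(0,1)$ if $(1-\varepsilon)\|v\|_2\le\|\Phi v\|_2\le(1+\varepsilon)\|v\|_2$ for all $m$-sparse vectors $v$. Regularized Orthogonal Matching Pursuit (ROMP) is the following algorithm. Input: measurement vector $x\in\mathbb{R}^N$ and sparsity level $n$. Output: index set $I\subset\{1,\dots,d\}$, reconstructed vector $\hat v=y$. Initialize: let the index set $I=\emptyset$ and the residual $r=x$.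 Repeat the following steps $n$ times or until $|I|\ge 2n$. Identify: choose a set $J$ of the $n$ biggest nonzero coordinates in magnitude of the observation vector $u=\Phi^*r$, or all of its nonzero coordinates, whichever set is smaller. Regularize: among all subsets $J_0\subset J$ with comparable coordinates, i.e. $|u(i)|\le 2|u(j)|$ for all $i,j\in J_0$, choose $J_0$ with the maximal energy $\|u|_{J_0}\|_2$. Update: add the set $J_0$ to the index set, $I\leftarrow I\cup J_0$, and update the residual: $y=\arg\min_{z\in\mathbb{R}^I}\|x-\Phi z\|_2$, $r=x-\Phi y$.
   Formalization: ROMP is run with sparsity level 2n (2n steps, or until |I| ≥ 4n) instead of n, since with level n the bound fails for large n (Φ = Id, e = 0, v = (1, 1/3, …, 3^-n, 0, …)); n = 1, where ε is undefined, is excluded. *)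

(* Defs.v *)
From mathcomp Require Import all_boot all_order all_algebra.
From mathcomp Require Import reals exp.

Set Implicit Arguments.
Unset Strict Implicit.
Unset Printing Implicit Defensive.

Import Order.TTheory GRing.Theory Num.Theory.

Local Open Scope ring_scope.

(* Vectors of R^k are column vectors; MathComp-Analysis equips
   matrices with the sup norm, so the l1 and l2 norms are defined here. *)

Definition l2norm (R : realType) (k : nat) (x : 'cV[R]_k) : R :=
  Num.sqrt (\sum_(i < k) x i 0 ^+ 2).

Definition l1norm (R : realType) (k : nat) (x : 'cV[R]_k) : R :=
  \sum_(i < k) `|x i 0|.

Definition supp (R : realType) (k : nat) (x : 'cV[R]_k) : {set 'I_k} :=
  [set i | x i 0 != 0].

Definition sparse (R : realType) (k m : nat) (x : 'cV[R]_k) : Prop :=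
  (#|supp x| <= m)%N.

(* u|_I, seen as a vector of R^k supported in I. *)
Definition restrict_to (R : realType) (k : nat) (I : {set 'I_k}) (u : 'cV[R]_k) :
    'cV[R]_k :=
  \col_i (if i \in I then u i 0 else 0).

(* J consists of m biggest coordinates in magnitude of u among those in A, or
   is A itself if A has at most m elements. Ties may be broken arbitrarily, so
   this is a relation. *)
Definition biggest_coords (R : realType) (k m : nat) (A : {set 'I_k})
    (u : 'cV[R]_k) (J : {set 'I_k}) : Prop :=
  [/\ J \subset A, #|J| = minn m #|A| &
      forall i j : 'I_k, i \in J -> j \in A :\: J -> `|u j 0| <= `|u i 0|].

(* g is a possible value of f_m (it is unique up to ties in magnitude). *)
Definition biggest_part (R : realType) (k m : nat) (f g : 'cV[R]_k) : Prop :=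
  exists2 S : {set 'I_k},
    biggest_coords m [set: 'I_k] f S & g = restrict_to S f.

(* Since 1 / 0 = 0, requiring 0 < eps rules out the undefined
   eps = 0.01 / sqrt(log n) at n = 1. *)
Definition RIC (R : realType) (N d : nat) (Phi : 'M[R]_(N, d))
    (m : nat) (eps : R) : Prop :=
  0 < eps < 1 /\
  forall v : 'cV[R]_d, sparse m v ->
    (1 - eps) * l2norm v <= l2norm (Phi *m v) <= (1 + eps) * l2norm v.

Definition comparable_coords (R : realType) (k : nat) (u : 'cV[R]_k)
    (J0 : {set 'I_k}) : Prop :=
  forall i j : 'I_k, i \in J0 -> j \in J0 -> `|u i 0| <= 2 * `|u j 0|.

Definition regularize (R : realType) (k : nat) (u : 'cV[R]_k)
    (J J0 : {set 'I_k}) : Prop :=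
  [/\ J0 \subset J, comparable_coords u J0 &
      forall K : {set 'I_k}, K \subset J -> comparable_coords u K ->
        l2norm (restrict_to K u) <= l2norm (restrict_to J0 u)].

(* y is a minimizer of |x - Phi z|_2 over z in R^I. *)
Definition least_squares (R : realType) (N d : nat) (Phi : 'M[R]_(N, d))
    (x : 'cV[R]_N) (I : {set 'I_d}) (y : 'cV[R]_d) : Prop :=
  supp y \subset I /\
  forall z : 'cV[R]_d, supp z \subset I ->
    l2norm (x - Phi *m y) <= l2norm (x - Phi *m z).

Record romp_state (R : realType) (N d : nat) := RompState {
  romp_index : {set 'I_d};
  romp_residual : 'cV[R]_N;
  romp_estimate : 'cV[R]_d
}.

Definition romp_step (R : realType) (N d : nat) (Phi : 'M[R]_(N, d))
    (x : 'cV[R]_N) (n : nat) (s s' : romp_state R N d) : Prop :=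
  let u := Phi^T *m romp_residual s in
  exists J J0 : {set 'I_d},
    [/\ biggest_coords n (supp u) u J,
        regularize u J J0,
        romp_index s' = romp_index s :|: J0,
        least_squares Phi x (romp_index s') (romp_estimate s') &
        romp_residual s' = x - Phi *m romp_estimate s'].

(* romp_run Phi x n k s: some run of ROMP on the measurement vector x with
   sparsity level n performs k steps and is then in state s. The algorithm does
   not set y before the first step; the initial value 0 is the minimizer over
   the empty index set. *)
Inductive romp_run (R : realType) (N d : nat) (Phi : 'M[R]_(N, d))
    (x : 'cV[R]_N) (n : nat) : nat -> romp_state R N d -> Prop :=
| romp_init : romp_run Phi x n 0 (RompState set0 x 0)
| romp_next (k : nat) (s s' : romp_state R N d) :
    romp_run Phi x n k s ->
    (k < n)%N -> (#|romp_index s| < 2 * n)%N ->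
    romp_step Phi x n s s' ->
    romp_run Phi x n k.+1 s'.

(* (I, y) is an output of some run of ROMP; the choices of J, J0 and y need not
   be unique, hence a relation. *)
Definition romp_output (R : realType) (N d : nat) (Phi : 'M[R]_(N, d))
    (x : 'cV[R]_N) (n : nat) (I : {set 'I_d}) (y : 'cV[R]_d) : Prop :=
  exists k : nat, exists s : romp_state R N d,
    [/\ romp_run Phi x n k s,
        k = n \/ (2 * n <= #|romp_index s|)%N,
        I = romp_index s & y = romp_estimate s].

(* Main.v *)
Require Import Defs.
From mathcomp Require Import all_boot all_order all_algebra.
From mathcomp Require Import reals exp.
From mathcomp Require Import ring lra zify.

Import Order.TTheory GRing.Theory Num.Theory.

Local Open Scope ring_scope.

(** The proof first recovers [m]-sparse vectors [v] from [Phi *m v + e], where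
    [m = 2n], and then reduces arbitrary vectors to this case.

    Let [I] be the current index set, [y] the current estimate and [w = v - y]
    the current error. All sets of coordinates that occur have at most [4m]
    elements, and on those the restricted isometry condition makes
    [Phi^T *m Phi] close to the identity, with relative error
    [delta = 2 eps + eps ^+ 2]. So on few coordinates the observation vector
    [u = Phi^T *m (Phi *m w + e)] equals [w] up to a noise level
    [eta = delta |w| + (1 + eps) |e|] ([RIC_observation]). By the normal
    equations [u] vanishes on [I], where [w] is therefore of size at most [eta];
    off [I], [w] is the part of [v] still missed. This controls the whole error
    by the missed part ([estimate_error]).

    Consider a round in which the set [J0] selected has at least as many
    coordinates outside the support of [v] as inside. On the former [w] vanishes,
    so [u] has norm at most [eta] there; comparability extends this to [J0], with
    a constant factor ([comparable_energy]); and maximality of [J0] extends it to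
    the identified set [J], with a factor [2 sqrt (ln m)], because [J] splits into
    about [log_2 m] comparable dyadic levels ([regularize_energy]). Since [J]
    captures more of [u] than the support of [v] does, the missed part has norm at
    most [6 sqrt (ln m) eta]. As [delta sqrt (ln m)] is small, [delta |w|] is
    absorbed, and the missed part is at most [9 sqrt (ln m) |e|]
    ([wrong_selection_error]). This bound persists as [I] grows. If no such round
    occurs, then every round gains a coordinate of the support, and at least
    half of those selected are in the support, so that after [m] rounds or [2m]
    coordinates nothing is missed ([romp_invariant], [romp_stability]).

    For arbitrary [v], the tail [h = v - v_2n] is regarded as part of the noise.
    Cutting [h] into blocks of [n] coordinates of decreasing magnitude,
    the norm of each block is at most the [l1] norm of the preceding one divided
    by [sqrt n] ([RIC_tail]), and for the first block [n] coordinates of [v_2n]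
    play the role of the preceding one ([l1_tail]). Hence
    [|Phi *m h| <= (1 + eps) |v - v_n|_1 / sqrt n]. The constants obtained are well
    below 159, which leaves room for [eps] being calibrated to [ln n] while the
    algorithm runs with sparsity level [2n]. *)

(** * Sums over finite sets *)

(** Double counting: [#|B|] times the first sum and [#|A|] times the second are
    both sums over the pairs in [A * B], where they compare termwise. *)
Lemma ler_sum_card {R : realType} {T : finType} (A B : {set T}) (F G : T -> R) :
    (#|A| <= #|B|)%N ->
    (forall a b, a \in A -> b \in B -> F a <= G b) ->
    (forall b, b \in B -> 0 <= G b) ->
  \sum_(a in A) F a <= \sum_(b in B) G b.
Proof.
move=> leAB leFG G_ge0.
have sumG_ge0 : 0 <= \sum_(b in B) G b by apply: sumr_ge0.
have [B0|B_gt0] := posnP #|B|.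
  move: leAB; rewrite B0 leqn0 => /eqP/cards0_eq->.
  by rewrite big_set0.
have B_gt0R : 0 < #|B|%:R :> R by rewrite ltr0n.
rewrite -(ler_pM2l B_gt0R).
apply: (@le_trans _ _ (#|A|%:R * \sum_(b in B) G b)); last first.
  by apply: ler_wpM2r => //; rewrite ler_nat.
rewrite !mulr_natl -!sumrMnl.
under eq_bigr => a _ do rewrite -sumr_const.
under [leRHS]eq_bigr => b _ do rewrite -sumr_const.
rewrite [leRHS]exchange_big /=.
by apply: ler_sum => a aA; apply: ler_sum => b bB; apply: leFG.
Qed.

(** * Euclidean norms *)

Definition dot {R : realType} {k : nat} (f g : 'cV[R]_k) : R :=
  \sum_i f i 0 * g i 0.

Section Dot.
Context {R : realType} {k : nat}.
Implicit Types (f g h : 'cV[R]_k) (A B : {set 'I_k}).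

Lemma dotC f g : dot f g = dot g f.
Proof. by apply: eq_bigr => i _; rewrite mulrC. Qed.

Lemma dotDl f g h : dot (f + g) h = dot f h + dot g h.
Proof. by rewrite /dot -big_split; apply: eq_bigr => i _; rewrite mxE mulrDl. Qed.

Lemma dotZl a f g : dot (a *: f) g = a * dot f g.
Proof. by rewrite /dot mulr_sumr; apply: eq_bigr => i _; rewrite mxE mulrA. Qed.

Lemma dotNl f g : dot (- f) g = - dot f g.
Proof. by rewrite -scaleN1r dotZl mulN1r. Qed.

Lemma dotDr f g h : dot h (f + g) = dot h f + dot h g.
Proof. by rewrite dotC dotDl !(dotC h). Qed.

Lemma dotZr a f g : dot g (a *: f) = a * dot g f.
Proof. by rewrite dotC dotZl dotC. Qed.

Lemma dotNr f g : dot g (- f) = - dot g f.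
Proof. by rewrite dotC dotNl dotC. Qed.

Definition dotE := (dotDl, dotDr, dotNl, dotNr, dotZl, dotZr).

Lemma l2norm_ge0 f : 0 <= l2norm f.
Proof. exact: sqrtr_ge0. Qed.

Lemma sqr_l2norm f : l2norm f ^+ 2 = dot f f.
Proof.
rewrite sqr_sqrtr; first by apply: eq_bigr => i _; rewrite expr2.
by apply: sumr_ge0 => i _; apply: sqr_ge0.
Qed.

Lemma l2normZ a f : l2norm (a *: f) = `|a| * l2norm f.
Proof.
apply/eqP; rewrite -(@eqrXn2 _ 2) ?mulr_ge0 ?l2norm_ge0 //.
by rewrite exprMn !sqr_l2norm !dotE real_normK ?num_real // expr2 mulrA.
Qed.

Lemma l2normN f : l2norm (- f) = l2norm f.
Proof. by rewrite -scaleN1r l2normZ normrN1 mul1r. Qed.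

(** Applied to a bilinear [p] and norms [x], [y], this turns a bound by the
    mean of two squares into a bound by the product: the first argument may be
    rescaled by any [s], and [s = p / (c x ^+ 2)] is optimal. *)
Lemma amgm_rescale (c p x y : R) : 0 <= c -> 0 <= x -> 0 <= y ->
    (forall s, 2 * (s * p) <= c * ((s * x) ^+ 2 + y ^+ 2)) ->
  p <= c * x * y.
Proof.
move=> c_ge0 x_ge0 y_ge0 le_p.
have cxy_ge0 : 0 <= c * x * y by rewrite !mulr_ge0.
have [p_le0|p_gt0] := leP p 0; first exact: le_trans cxy_ge0.
have [cx0|cx_neq0] := eqVneq (c * x) 0.
  have := le_p ((c * y ^+ 2 + 1) / p); rewrite mulfVK ?gt_eqF //.
  have -> r : c * ((r * x) ^+ 2 + y ^+ 2) = c * x * (r ^+ 2 * x) + c * y ^+ 2 by ring.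
  rewrite cx0 mul0r.
  have : 0 <= c * y ^+ 2 by rewrite mulr_ge0 ?sqr_ge0.
  by lra.
have /norP[c_neq0 x_neq0] : ~~ ((c == 0) || (x == 0)) by rewrite -mulf_eq0.
have cx2_gt0 : 0 < c * x ^+ 2 by rewrite mulr_gt0 ?exprn_gt0 ?lt_def ?c_neq0 ?x_neq0.
have := le_p (p / (c * x ^+ 2)).
have -> : 2 * (p / (c * x ^+ 2) * p) = 2 * (p ^+ 2 / (c * x ^+ 2)) by ring.
have -> : c * ((p / (c * x ^+ 2) * x) ^+ 2 + y ^+ 2) =
          p ^+ 2 / (c * x ^+ 2) + c * y ^+ 2.
  by field; rewrite c_neq0 x_neq0.
move=> le_p2.
have : p ^+ 2 / (c * x ^+ 2) <= c * y ^+ 2 by lra.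
rewrite ler_pdivrMr // => le_p3.
rewrite -ler_sqr ?nnegrE // ?(ltW p_gt0) //.
by apply: le_trans le_p3 _; rewrite le_eqVlt; apply/orP; left; apply/eqP; ring.
Qed.

Lemma dot_le_l2norm f g : dot f g <= l2norm f * l2norm g.
Proof.
rewrite -[l2norm f]mul1r; apply: amgm_rescale; rewrite ?l2norm_ge0 ?ler01 // => s.
have := sqr_ge0 (l2norm (s *: f - g)).
rewrite exprMn !sqr_l2norm !dotE (dotC g f); lra.
Qed.

Lemma ler_l2normD f g : l2norm (f + g) <= l2norm f + l2norm g.
Proof.
rewrite -ler_sqr ?nnegrE ?addr_ge0 ?l2norm_ge0 //.
have := dot_le_l2norm f g.
rewrite sqrrD !sqr_l2norm !dotE (dotC g f); lra.
Qed.

Lemma l2norm0 : l2norm (0 : 'cV[R]_k) = 0.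
Proof. by rewrite -(scale0r 0) l2normZ normr0 mul0r. Qed.

Lemma restrict_toE A f i : restrict_to A f i 0 = if i \in A then f i 0 else 0.
Proof. by rewrite mxE. Qed.

Lemma dot_restrict A f g : dot f (restrict_to A g) = \sum_(i in A) f i 0 * g i 0.
Proof.
rewrite /dot [RHS]big_mkcond; apply: eq_bigr => i _.
by rewrite restrict_toE; case: ifP => // _; rewrite mulr0.
Qed.

Lemma sqr_l2norm_restrict A f : l2norm (restrict_to A f) ^+ 2 = \sum_(i in A) f i 0 ^+ 2.
Proof.
rewrite sqr_l2norm dot_restrict; apply: eq_bigr => i iA.
by rewrite restrict_toE iA expr2.
Qed.

Lemma restrictB A f g : restrict_to A (f - g) = restrict_to A f - restrict_to A g.
Proof. by apply/colP => i; rewrite !mxE; case: ifP; rewrite ?subrr. Qed.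

Lemma restrict_split A f : f = restrict_to A f + restrict_to (~: A) f.
Proof.
by apply/colP => i; rewrite !mxE inE; case: (i \in A); rewrite ?addr0 ?add0r.
Qed.

Lemma restrict_id A f : supp f \subset A -> restrict_to A f = f.
Proof.
move/subsetP => fA; apply/colP => i; rewrite mxE; case: ifPn => // /negP iA.
by have [//|fi] := eqVneq (f i 0) 0; case: iA; apply: fA; rewrite inE.
Qed.

Lemma restrict0 f : restrict_to set0 f = 0.
Proof. by apply/colP => i; rewrite !mxE inE. Qed.

Lemma supp_restrict A f : supp (restrict_to A f) \subset A.
Proof.
by apply/subsetP => i; rewrite inE restrict_toE; case: ifP => //; rewrite eqxx.
Qed.

Lemma suppP A f : reflect (forall i, i \notin A -> f i 0 = 0) (supp f \subset A).
Proof.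
apply: (iffP subsetP) => [fA i iA|fA i].
  by apply/eqP; apply: contraR iA => fi; apply: fA; rewrite inE.
by rewrite inE; apply: contraR => /fA->.
Qed.

Lemma supp_add A f g : supp f \subset A -> supp g \subset A -> supp (f + g) \subset A.
Proof.
by move=> /suppP fA /suppP gA; apply/suppP => i iA; rewrite mxE fA ?gA ?addr0.
Qed.

Lemma supp_scale A a f : supp f \subset A -> supp (a *: f) \subset A.
Proof. by move=> /suppP fA; apply/suppP => i iA; rewrite mxE fA ?mulr0. Qed.

Lemma supp_opp A f : supp f \subset A -> supp (- f) \subset A.
Proof. by rewrite -scaleN1r; apply: supp_scale. Qed.

Lemma l2norm_restrict_sub A B f :
  A \subset B -> l2norm (restrict_to A f) <= l2norm (restrict_to B f).
Proof.
move=> AB; rewrite -ler_sqr ?nnegrE ?l2norm_ge0 // !sqr_l2norm_restrict.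
rewrite [leRHS](big_setID A) (setIidPr AB) lerDl.
by apply: sumr_ge0 => i _; apply: sqr_ge0.
Qed.

End Dot.

Lemma dot_mulmx {R : realType} {N d : nat} (Phi : 'M[R]_(N, d)) (f : 'cV_N) (g : 'cV_d) :
  dot f (Phi *m g) = dot (Phi^T *m f) g.
Proof.
have dot_mx k (x y : 'cV[R]_k) : dot x y = (x^T *m y) 0 0.
  by rewrite mxE; apply: eq_bigr => i _; rewrite mxE.
by rewrite !dot_mx trmx_mul trmxK mulmxA.
Qed.

(** * Biggest coordinates and regularization *)

(** Greedily, one coordinate at a time. *)
Lemma exists_biggest_coords {R : realType} {k : nat} (m : nat) (A : {set 'I_k})
  (u : 'cV[R]_k) : exists J, biggest_coords m A u J.
Proof.
elim: m => [|m [J [JA cardJ leJ]]].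
  by exists set0; split=> [||i j]; rewrite ?sub0set ?cards0 ?min0n ?inE.
have [AJ|[i0 i0AJ]] := set_0Vmem (A :\: J).
  have eqJ : J = A by apply/eqP; rewrite eqEsubset JA -setD_eq0 AJ eqxx.
  exists A; split=> [||i j]; rewrite ?subxx ?setDv ?inE //.
  by move: cardJ; rewrite eqJ; lia.
case: (arg_maxP (fun i => `|u i 0|) i0AJ) => i1 i1AJ max_i1.
have /setDP[i1A i1J] := i1AJ.
exists (i1 |: J); split=> [||i j].
- by rewrite subUset sub1set i1A.
- have /subset_leq_card : i1 |: J \subset A by rewrite subUset sub1set i1A.
  by rewrite cardsU1 i1J cardJ add1n; move: #|A| => c; lia.
- move=> iJ /setDP[jA]; rewrite in_setU1 negb_or => /andP[_ jJ].
  have jAJ : j \in A :\: J by rewrite inE jJ.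
  by case/setU1P: iJ => [->|iJ]; [apply: max_i1|apply: leJ].
Qed.

(** Exchange the coordinates of [S] outside [J] with those of [J] outside [S]. *)
Lemma biggest_coords_energy {R : realType} {k : nat} {m : nat} {u : 'cV[R]_k}
    {J S : {set 'I_k}} :
    biggest_coords m (supp u) u J -> (#|S| <= m)%N ->
  l2norm (restrict_to S u) <= l2norm (restrict_to J u).
Proof.
move=> [JA cardJ leJ] leSm; rewrite -ler_sqr ?nnegrE ?l2norm_ge0 //.
have -> : restrict_to S u = restrict_to (S :&: supp u) u.
  by apply/colP => i; rewrite !mxE !inE; case: eqP => [->|]; rewrite ?andbT // !if_same.
have : (#|S :&: supp u| <= #|J|)%N.
  by rewrite cardJ leq_min (leq_trans (subset_leq_card (subsetIl _ _))) //
    subset_leq_card ?subsetIr.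
have : S :&: supp u \subset supp u by apply: subsetIr.
move: (S :&: supp u) => T TA leTJ.
rewrite !sqr_l2norm_restrict [leLHS](big_setID J) [leRHS](big_setID T) /= setIC.
rewrite lerD2l; apply: ler_sum_card => [|i j|j _]; last exact: sqr_ge0.
- by rewrite -(leq_add2l #|T :&: J|) cardsID setIC cardsID.
- move=> /setDP[iT iJ] /setDP[jJ jT]; rewrite -(real_normK (num_real (u i 0))).
  rewrite -(real_normK (num_real (u j 0))) ler_sqr ?nnegrE //.
  by apply: leJ => //; rewrite inE iJ (subsetP TA).
Qed.

(** Induction on the number of dyadic levels: the coordinates of magnitude
    between [M / 2] and [M] form a comparable set, and removing them halves the
    bound [M], which divides the trivial energy bound [#|J| * M ^+ 2] by 4. *)
Lemma dyadic_energy {R : realType} {d : nat} {u : 'cV[R]_d} {E : R} (k : nat) :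
  forall (J : {set 'I_d}) (M : R), 0 <= M ->
    (forall K : {set 'I_d}, K \subset J -> comparable_coords u K ->
       \sum_(i in K) u i 0 ^+ 2 <= E) ->
    (forall i, i \in J -> `|u i 0| <= M) ->
  \sum_(i in J) u i 0 ^+ 2 <= k%:R * E + #|J|%:R * M ^+ 2 / 4 ^+ k.
Proof.
elim: k => [|k IHk] J M M_ge0 leE leM.
  rewrite mul0r add0r expr0 divr1 mulr_natl -sumr_const; apply: ler_sum => i iJ.
  by rewrite -(real_normK (num_real (u i 0))) ler_sqr ?nnegrE // leM.
pose B := [set i | M / 2 < `|u i 0|].
rewrite (big_setID B) /=.
have sumB : \sum_(i in J :&: B) u i 0 ^+ 2 <= E.
  apply: leE => [|i j]; first exact: subsetIl.
  rewrite !inE => /andP[iJ _] /andP[_ jB].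
  by have := leM i iJ; lra.
have {}IHk : \sum_(i in J :\: B) u i 0 ^+ 2
    <= k%:R * E + #|J :\: B|%:R * (M / 2) ^+ 2 / 4 ^+ k.
  apply: IHk => [|K KJ|i]; first by rewrite divr_ge0.
  - by apply: leE; apply: subset_trans KJ (subsetDl _ _).
  - by rewrite !inE -leNgt => /andP[].
have leDJ : #|J :\: B|%:R * (M / 2) ^+ 2 / 4 ^+ k <= #|J|%:R * M ^+ 2 / 4 ^+ k.+1.
  have -> : #|J :\: B|%:R * (M / 2) ^+ 2 / 4 ^+ k =
            #|J :\: B|%:R * (M ^+ 2 / 4 ^+ k.+1) :> R.
    by rewrite [4 ^+ k.+1]exprS; field; rewrite expf_neq0 ?pnatr_eq0.
  rewrite -[leRHS]mulrA; apply: ler_wpM2r.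
    by rewrite divr_ge0 ?exprn_ge0 ?sqr_ge0.
  by rewrite ler_nat subset_leq_card // subsetDl.
by rewrite -natr1 mulrDl mul1r; lra.
Qed.

Lemma ln2_ge_half {R : realType} : 1 / 2 <= ln (2 : R).
Proof.
have := @le_ln1Dx R (- (1 / 2)).
have -> : 1 + - (1 / 2) = 2^-1 :> R by field.
by rewrite lnV ?posrE // lerN2 => -> //; lra.
Qed.

Lemma ln_nat_ge1 {R : realType} (m : nat) : (4 <= m)%N -> 1 <= ln (m%:R : R).
Proof.
move=> m_ge4; apply: (@le_trans _ _ (ln (4 : R))).
  have -> : 4 = 2 * 2 :> R by ring.
  by rewrite lnM ?posrE //; have := @ln2_ge_half R; lra.
by rewrite ler_ln ?posrE ?ltr0n ?ler_nat //; lia.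
Qed.

(** With [k + 1 > log_2 m] dyadic levels below the biggest magnitude [M] in [J],
    what remains has energy at most [m * M ^+ 2 / 4 ^+ k.+1 <= M ^+ 2], which is
    the energy of a singleton. So the [m] coordinates carry the energy of at most
    [log_2 m + 2] comparable sets, and [ln 2 >= 1 / 2], [ln m >= 1]. *)
Lemma regularize_energy {R : realType} {d m : nat} {u : 'cV[R]_d} {J J0 : {set 'I_d}} :
    (4 <= m)%N -> (#|J| <= m)%N -> regularize u J J0 ->
  l2norm (restrict_to J u) ^+ 2 <= 4 * ln m%:R * l2norm (restrict_to J0 u) ^+ 2.
Proof.
move=> m_ge4 leJm [_ _ maxJ0].
have ln_ge1 := @ln_nat_ge1 R m m_ge4.
set E := l2norm (restrict_to J0 u) ^+ 2.
have leE (K : {set 'I_d}) : K \subset J -> comparable_coords u K ->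
    \sum_(i in K) u i 0 ^+ 2 <= E.
  by move=> KJ cK; rewrite -sqr_l2norm_restrict ler_sqr ?nnegrE ?l2norm_ge0 ?maxJ0.
have E_ge0 : 0 <= E by apply: sqr_ge0.
have [J_0|[i0 i0J]] := set_0Vmem J.
  by rewrite J_0 restrict0 l2norm0 expr0n; apply: mulr_ge0 => //; lra.
case: (arg_maxP (fun i => `|u i 0|) i0J) => i1 i1J max_i1.
have leM : `|u i1 0| ^+ 2 <= E.
  rewrite real_normK ?num_real //.
  have -> : u i1 0 ^+ 2 = \sum_(i in [set i1]) u i 0 ^+ 2 by rewrite big_set1.
  apply: leE => [|i j]; first by rewrite sub1set.
  by rewrite !inE => /eqP-> /eqP->; have := normr_ge0 (u i1 0); lra.
have m_gt0 : (0 < m)%N by lia.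
have := dyadic_energy (trunc_log 2 m).+1 _ _ (normr_ge0 (u i1 0)) leE max_i1.
have := trunc_log_ltn m (isT : 1 < 2)%N; have := trunc_logP (isT : 1 < 2)%N m_gt0.
move: (trunc_log 2 m) => k le_km lt_mk.
rewrite sqr_l2norm_restrict => /le_trans; apply.
have le_k : k%:R <= 2 * ln (m%:R : R).
  have : ln ((2 ^ k)%:R : R) <= ln m%:R.
    by rewrite ler_ln ?posrE ?ltr0n ?expn_gt0 ?ler_nat.
  rewrite natrX lnXn //.
  rewrite -[_ *+ k]mulr_natl; have := @ln2_ge_half R.
  have : 0 <= k%:R :> R by [].
  nra.
have le_rest : #|J|%:R * `|u i1 0| ^+ 2 / 4 ^+ k.+1 <= E.
  rewrite ler_pdivrMr ?exprn_gt0 // [leRHS]mulrC; apply: ler_pM => //.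
    by rewrite exprn_ge0.
  rewrite -natrX ler_nat (leq_trans leJm) // (leq_trans (ltnW lt_mk)) //.
  exact: leq_exp2r.
have : (k%:R + 2) * E <= 4 * ln m%:R * E by apply: ler_wpM2r => //; lra.
by rewrite -natr1; lra.
Qed.

(** * Restricted isometries *)

Section RIC.
Context {R : realType} {N d M : nat} {Phi : 'M[R]_(N, d)} {eps : R}.
Hypothesis Phi_RIC : RIC Phi M eps.

Lemma RIC_le {A : {set 'I_d}} {z : 'cV[R]_d} : supp z \subset A -> (#|A| <= M)%N ->
  l2norm (Phi *m z) <= (1 + eps) * l2norm z.
Proof.
case: Phi_RIC => _ iso zA AM.
by have /andP[] := iso z (leq_trans (subset_leq_card zA) AM).
Qed.

Lemma RIC_sqr {A : {set 'I_d}} {z : 'cV[R]_d} : supp z \subset A -> (#|A| <= M)%N ->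
  `|l2norm (Phi *m z) ^+ 2 - l2norm z ^+ 2| <= (2 * eps + eps ^+ 2) * l2norm z ^+ 2.
Proof.
case: Phi_RIC => /andP[eps_gt0 eps_lt1] iso zA AM.
have /andP[] := iso z (leq_trans (subset_leq_card zA) AM).
have := l2norm_ge0 z; have := l2norm_ge0 (Phi *m z).
move: (l2norm _) (l2norm z) => b a b_ge0 a_ge0 lo hi.
have lo2 : ((1 - eps) * a) ^+ 2 <= b ^+ 2.
  by rewrite ler_sqr ?nnegrE // mulr_ge0 //; lra.
have hi2 : b ^+ 2 <= ((1 + eps) * a) ^+ 2.
  by rewrite ler_sqr ?nnegrE // mulr_ge0 //; lra.
have : 0 <= eps ^+ 2 * a ^+ 2 by rewrite mulr_ge0 ?sqr_ge0.
move=> eps2_ge0; rewrite ler_norml; move: lo2 hi2; rewrite !exprMn => lo2 hi2.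
by rewrite sqrrB in lo2; rewrite sqrrD in hi2; apply/andP; split; nra.
Qed.

(** Polarization of the preceding bound, which applies to both [f + g] and
    [f - g] because their supports lie in the common set [A]. *)
Lemma RIC_dot {A : {set 'I_d}} {f g : 'cV[R]_d} :
    supp f \subset A -> supp g \subset A -> (#|A| <= M)%N ->
  dot (Phi *m f) (Phi *m g) - dot f g <=
    (2 * eps + eps ^+ 2) * l2norm f * l2norm g.
Proof.
move=> fA gA AM; have [/andP[eps_gt0 _] _] := Phi_RIC.
have delta_ge0 : 0 <= 2 * eps + eps ^+ 2.
  by rewrite addr_ge0 ?sqr_ge0 // mulr_ge0 // ltW.
apply: amgm_rescale; rewrite ?l2norm_ge0 // => s.
have sfA := supp_scale _ s _ fA.
have := RIC_sqr (supp_add _ _ _ sfA gA) AM.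
have := RIC_sqr (supp_add _ _ _ sfA (supp_opp _ _ gA)) AM.
move=> /ler_normlP[+ _] /ler_normlP[_ +].
rewrite exprMn !sqr_l2norm !mulmxDr !mulmxN -!scalemxAr !dotE.
rewrite (dotC g f) (dotC (Phi *m g)).
by move: (2 * eps + eps ^+ 2) => delta; nra.
Qed.

(** Duality: the squared norm of the left-hand vector [g] is its inner product
    with [Phi^T *m (Phi *m w + e) - w], which moves to inner products of
    [Phi *m w] and [e] with [Phi *m g]; then divide by the norm of [g]. *)
Lemma RIC_observation {A : {set 'I_d}} (T : {set 'I_d}) {w : 'cV[R]_d} (e : 'cV[R]_N) :
    supp w \subset A -> (#|A :|: T| <= M)%N ->
  l2norm (restrict_to T (Phi^T *m (Phi *m w + e) - w)) <=
    (2 * eps + eps ^+ 2) * l2norm w + (1 + eps) * l2norm e.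
Proof.
move=> wA ATM; set h := _ - w; set g := restrict_to T h.
have [g0|g_neq0] := eqVneq (l2norm g) 0.
  have [/andP[eps_gt0 _] _] := Phi_RIC.
  rewrite g0 addr_ge0 // mulr_ge0 ?l2norm_ge0 ?addr_ge0 ?mulr_ge0 ?sqr_ge0 ?ltW //.
have g_gt0 : 0 < l2norm g by rewrite lt_def g_neq0 l2norm_ge0.
have gAT : supp g \subset A :|: T.
  exact: subset_trans (supp_restrict _ _) (subsetUr _ _).
have wAT : supp w \subset A :|: T by exact: subset_trans wA (subsetUl _ _).
rewrite -(ler_pM2r g_gt0) -expr2.
have -> : l2norm g ^+ 2 = dot (Phi *m w) (Phi *m g) - dot w g + dot e (Phi *m g).
  rewrite sqr_l2norm_restrict.
  have -> : \sum_(i in T) h i 0 ^+ 2 = dot h g.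
    by rewrite dot_restrict; apply: eq_bigr => i _; rewrite expr2.
  by rewrite /h !dotE -dot_mulmx !dotE; lra.
have := RIC_dot wAT gAT ATM.
have := dot_le_l2norm e (Phi *m g).
have := ler_wpM2l (l2norm_ge0 e) (RIC_le gAT ATM).
by move: (2 * eps + eps ^+ 2) => delta; lra.
Qed.

(** Split off the [n] biggest coordinates [T] of [h]. Their norm is at most
    [sqrt n * a], and the remaining coordinates are at most the average
    [a'] over [T], so that [n a'] is the [l1] norm of the block just removed: the norm of
    each block is paid for by the preceding one. *)
Lemma RIC_tail {n : nat} : (0 < n <= M)%N -> forall {h : 'cV[R]_d} {a : R}, 0 <= a ->
    (forall i, `|h i 0| <= a) ->
  l2norm (Phi *m h) <= (1 + eps) * ((n%:R * a + l1norm h) / Num.sqrt n%:R).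
Proof.
move=> /andP[n_gt0 nM] h.
have [/andP[eps_gt0 _] _] := Phi_RIC.
have nR_gt0 : 0 < n%:R :> R by rewrite ltr0n.
set q := Num.sqrt n%:R.
have q_gt0 : 0 < q by rewrite sqrtr_gt0.
have q2 : q ^+ 2 = n%:R by rewrite sqr_sqrtr // ltW.
have [s] := ubnP #|supp h|; elim: s h => // s IHs h; rewrite ltnS => le_s a a_ge0 leh.
have rhs_ge0 : 0 <= (1 + eps) * ((n%:R * a + l1norm h) / q).
  rewrite mulr_ge0 ?divr_ge0 ?(ltW q_gt0) ?addr_ge0 ?mulr_ge0 ?(ltW eps_gt0) //.
  exact: sumr_ge0.
have [h_0|[i0 i0h]] := set_0Vmem (supp h).
  have h0 : h = 0 by rewrite -(restrict_id set0 h) ?h_0 // restrict0.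
  by rewrite [X in Phi *m X]h0 mulmx0 l2norm0.
have [T [Th cardT leT]] := exists_biggest_coords n (supp h) h.
have T_gt0 : (0 < #|T|)%N.
  by rewrite cardT leq_min n_gt0; apply/card_gt0P; exists i0.
pose h' := restrict_to (~: T) h.
pose a' := (\sum_(i in T) `|h i 0|) / n%:R.
have a'_ge0 : 0 <= a' by apply: divr_ge0 => //; apply: sumr_ge0.
have supp_h' : supp h' = supp h :\: T.
  by apply/setP => i; rewrite !inE restrict_toE inE; case: (i \in T); rewrite ?eqxx.
have lt_h' : (#|supp h'| < s)%N.
  apply: leq_trans le_s; rewrite supp_h'.
  by have := cardsID T (supp h); rewrite (setIidPr Th); lia.
have leh' i : `|h' i 0| <= a'.
  have [ih'|] := boolP (i \in supp h'); last first.
    by rewrite inE negbK => /eqP->; rewrite normr0.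
  rewrite ler_pdivlMr // mulrC.
  have cardTn : #|T| = n.
    move: ih'; rewrite supp_h' => /setDP[ih iT].
    have /subset_leq_card : i |: T \subset supp h by rewrite subUset sub1set ih.
    rewrite cardsU1 iT add1n cardT => lt_nh; apply/minn_idPl.
    rewrite leqNgt; apply/negP => /ltnW/minn_idPr eq_h.
    by rewrite eq_h ltnn in lt_nh.
  rewrite mulr_natl -cardTn -sumr_const; apply: ler_sum => j jT.
  have /setDP[ih iT] : i \in supp h :\: T by rewrite -supp_h'.
  by rewrite restrict_toE inE iT leT // inE iT.
have := IHs h' lt_h' a' a'_ge0 leh'.
have -> : n%:R * a' + l1norm h' = l1norm h.
  rewrite /a' mulrC divfK ?gt_eqF // [RHS](bigID (mem T)) /=; congr (_ + _).
  rewrite [RHS]big_mkcond; apply: eq_bigr => i _.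
  by rewrite restrict_toE inE; case: (i \in T) => //=; rewrite normr0.
have leT_M : (#|T| <= M)%N by rewrite cardT; lia.
have := RIC_le (supp_restrict T h) leT_M.
have leTa : l2norm (restrict_to T h) <= n%:R * a / q.
  have -> : n%:R * a / q = q * a by rewrite -q2; field; rewrite gt_eqF.
  rewrite -ler_sqr ?nnegrE ?l2norm_ge0 ?mulr_ge0 ?(ltW q_gt0) //.
  rewrite sqr_l2norm_restrict exprMn q2.
  apply: (@le_trans _ _ (\sum_(i in T) a ^+ 2)).
    apply: ler_sum => i _; rewrite -(real_normK (num_real (h i 0))).
    by rewrite ler_sqr ?nnegrE.
  rewrite sumr_const -[leLHS]mulr_natl; apply: ler_wpM2r; first exact: sqr_ge0.
  by rewrite ler_nat cardT geq_minl.
have := ler_l2normD (Phi *m restrict_to T h) (Phi *m h').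
rewrite -mulmxDr -restrict_split mulrDl.
have : (1 + eps) * l2norm (restrict_to T h) <= (1 + eps) * (n%:R * a / q).
  by apply: ler_wpM2l => //; lra.
lra.
Qed.

End RIC.

(** Normal equations: otherwise a small step from [y] along the coordinate [i]
    would decrease the residual. *)
Lemma least_squares_orthogonal {R : realType} {N d : nat} {Phi : 'M[R]_(N, d)}
    {x : 'cV[R]_N} {I : {set 'I_d}} {y : 'cV[R]_d} (i : 'I_d) :
  least_squares Phi x I y -> i \in I -> (Phi^T *m (x - Phi *m y)) i 0 = 0.
Proof.
move=> [yI min_y] iI; set r := x - Phi *m y; set b := _ i 0.
pose g : 'cV[R]_d := delta_mx i 0.
have gE j : g j 0 = (j == i)%:R by rewrite mxE eqxx andbT.
have gI : supp g \subset I.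
  apply/suppP => j; apply: contraNeq; rewrite gE.
  by case: (eqVneq j i) => [->//|_]; rewrite eqxx.
have rg : dot r (Phi *m g) = b.
  rewrite dot_mulmx /dot (bigD1 i) //= big1 => [|j /negPf ji].
    by rewrite gE eqxx mulr1 addr0.
  by rewrite gE ji mulr0.
pose a := l2norm (Phi *m g) ^+ 2.
have a_ge0 : 0 <= a by apply: sqr_ge0.
(* The optimal step is b / a; dividing by a + 1 also covers a = 0. *)
have := min_y (y + (b / (a + 1)) *: g) (supp_add _ _ _ yI (supp_scale _ _ _ gI)).
rewrite -ler_sqr ?nnegrE ?l2norm_ge0 // mulmxDr -scalemxAr opprD addrA -/r.
move: rg; clearbody b r => rg.
rewrite !sqr_l2norm !dotE (dotC (Phi *m g) r) rg -!sqr_l2norm -/a => le_r.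
have a1_neq0 : a + 1 != 0 by rewrite gt_eqF // ltr_wpDl.
have : b ^+ 2 * (a + 2) / (a + 1) ^+ 2 <= 0.
  have -> : b ^+ 2 * (a + 2) / (a + 1) ^+ 2 =
      2 * (b / (a + 1) * b) - b / (a + 1) * (b / (a + 1) * a) by field.
  move: le_r; move: (b / (a + 1)) => c; lra.
have a1_gt0 : 0 < (a + 1) ^+ 2 by rewrite exprn_gt0 ?ltr_wpDl.
have a2_gt0 : 0 < a + 2 by rewrite ltr_wpDl.
rewrite pmulr_lle0 ?invr_gt0 // pmulr_lle0 //.
by move=> b2; apply/eqP; rewrite -sqrf_eq0 eq_le b2 sqr_ge0.
Qed.

(** * Stability of the algorithm on sparse vectors *)

Lemma ler_of_sqr_scaled {R : realType} {c a b : R} : 0 <= c -> 0 <= a -> 0 <= b ->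
  a ^+ 2 <= c ^+ 2 * b ^+ 2 -> a <= c * b.
Proof. by move=> c0 a0 b0; rewrite -exprMn ler_sqr ?nnegrE ?mulr_ge0. Qed.

(** Each coordinate inside [S] has at most 4 times the energy of any coordinate
    outside [S], and the latter are at least as numerous. *)
Lemma comparable_energy {R : realType} {d : nat} {u : 'cV[R]_d} {J0 S : {set 'I_d}} :
    comparable_coords u J0 -> (#|J0 :&: S| <= #|J0 :\: S|)%N ->
  l2norm (restrict_to J0 u) ^+ 2 <= 5 * l2norm (restrict_to (J0 :\: S) u) ^+ 2.
Proof.
move=> cJ0 leS; rewrite !sqr_l2norm_restrict (big_setID S) /=.
have : \sum_(i in J0 :&: S) u i 0 ^+ 2 <= \sum_(i in J0 :\: S) 4 * u i 0 ^+ 2.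
  apply: ler_sum_card => // [i j /setIP[iJ0 _] /setDP[jJ0 _]|j _].
    rewrite -(real_normK (num_real (u i 0))) -(real_normK (num_real (u j 0))).
    have -> : 4 * `|u j 0| ^+ 2 = (2 * `|u j 0|) ^+ 2 by ring.
    by rewrite ler_sqr ?nnegrE ?mulr_ge0 // cJ0.
  by rewrite mulr_ge0 ?sqr_ge0.
rewrite -mulr_sumr; lra.
Qed.

Section Stability.
Context {R : realType} {N d m : nat} {Phi : 'M[R]_(N, d)} {eps : R}.
Hypothesis m_ge4 : (4 <= m)%N.
Hypothesis Phi_RIC : RIC Phi (4 * m) eps.
Let q := Num.sqrt (ln (m%:R : R)).
Hypothesis eps_q : eps * q <= 15 / 1000.
Context {v : 'cV[R]_d} {e : 'cV[R]_N}.
Hypothesis v_sparse : sparse m v.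
Let x := Phi *m v + e.
Let delta := 2 * eps + eps ^+ 2.

Lemma sqrt_ln_ge1 : 1 <= q.
Proof. by rewrite -[leLHS]sqrtr1 ler_wsqrtr // ln_nat_ge1. Qed.

Lemma RIC_eps_gt0 : 0 < eps.
Proof. by have [/andP[]] := Phi_RIC. Qed.

Lemma RIC_eps_le : eps <= 15 / 1000.
Proof. by have := sqrt_ln_ge1; have := RIC_eps_gt0; have := eps_q; nra. Qed.

Lemma delta_bounds : [/\ 0 <= delta, delta <= 31 / 1000 & delta * q <= 31 / 1000].
Proof.
have := sqrt_ln_ge1; have := RIC_eps_gt0; have := eps_q; have := RIC_eps_le => h1 h2 h3 h4.
have : eps * (eps * q) <= 15 / 1000 * (15 / 1000) by apply: ler_pM; nra.
by rewrite /delta => h5; split; nra.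
Qed.

Section Estimate.
Context {I : {set 'I_d}} {y : 'cV[R]_d}.
Hypothesis y_ls : least_squares Phi x I y.

Let u := Phi^T *m (x - Phi *m y).
Let w := v - y.

Lemma supp_error : supp w \subset supp v :|: I.
Proof.
by case: y_ls => yI _; apply: supp_add;
  [exact: subsetUl|apply/supp_opp/(subset_trans yI)/subsetUr].
Qed.

Lemma observation_error (T : {set 'I_d}) : (#|I :|: T| <= 3 * m)%N ->
  l2norm (restrict_to T (u - w)) <= delta * l2norm w + (1 + eps) * l2norm e.
Proof.
move=> leIT; rewrite /u; have -> : x - Phi *m y = Phi *m w + e.
  by rewrite mulmxBr addrAC.
apply: (RIC_observation Phi_RIC T e supp_error).
rewrite -setUA (leq_trans (leq_card_setU _ _).1) //.
by rewrite (mulnDl 1 3) mul1n leq_add.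
Qed.

Lemma restrict_off_estimate (T : {set 'I_d}) : [disjoint T & I] ->
  restrict_to T w = restrict_to T v.
Proof.
move=> dTI; apply/colP => i; rewrite !restrict_toE; case: ifPn => // iT.
have [/suppP yI _] := y_ls.
by rewrite 2!mxE yI ?oppr0 ?addr0 // (disjointFr dTI).
Qed.

(** On [I] the observation vector vanishes, so the estimate above bounds the
    error itself there; off [I] the error is [v]. *)
Lemma estimate_error : (#|I| <= 3 * m)%N ->
  (1 - delta) * l2norm w <= l2norm (restrict_to (~: I) v) + (1 + eps) * l2norm e.
Proof.
move=> leI.
have : l2norm (restrict_to I w) <= delta * l2norm w + (1 + eps) * l2norm e.
  rewrite -l2normN.
  have -> : - restrict_to I w = restrict_to I (u - w).
    apply/colP => i; rewrite [RHS]restrict_toE [LHS]mxE restrict_toE.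
    case: ifP => [iI|]; last by rewrite oppr0.
    by rewrite [RHS]mxE [(- w) _ _]mxE (least_squares_orthogonal i y_ls iI) add0r.
  by apply: observation_error; rewrite setUid.
rewrite -(@restrict_off_estimate (~: I)); last by rewrite disjoint_sym disjoints_subset setCK.
have := ler_l2normD (restrict_to I w) (restrict_to (~: I) w).
rewrite -restrict_split; lra.
Qed.

(** If at least half of the coordinates selected were outside the support of [v], where
    the observation vector is mere noise, then by regularization the whole
    identified set [J], hence also the part of [v] still missed, would be
    noise up to a factor of order [sqrt (ln m)]. *)
Lemma wrong_selection_error (J J0 : {set 'I_d}) :
    (#|I| <= 2 * m)%N ->
    biggest_coords m (supp u) u J -> regularize u J J0 ->
    (#|J0 :&: supp v| <= #|J0 :\: supp v|)%N ->
  l2norm (restrict_to (~: I) v) <= 9 * q * l2norm e.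
Proof.
move=> leI bigJ regJ0 le_wrong; have [J0J cJ0 _] := regJ0; have [Ju cardJ _] := bigJ.
have leJ : (#|J| <= m)%N by rewrite cardJ geq_minl.
have uI i : i \in I -> u i 0 = 0 by apply: least_squares_orthogonal.
pose T1 := J0 :\: supp v.
pose T0 := supp v :\: I.
have small (T : {set 'I_d}) : (#|T| <= m)%N -> (#|I :|: T| <= 3 * m)%N.
  move=> leT; rewrite (leq_trans (leq_card_setU _ _).1) //.
  by rewrite (mulnDl 2 1) mul1n leq_add.
have T1I : [disjoint T1 & I].
  rewrite disjoints_subset; apply/subsetP => i /setDP[iJ0 _]; rewrite inE.
  have : i \in supp u by rewrite (subsetP Ju) // (subsetP J0J).
  by rewrite inE; apply: contraNN => /uI->.
have T0I : [disjoint T0 & I].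
  by rewrite disjoints_subset; apply/subsetP => i /setDP[_ iI]; rewrite inE.
have noise : l2norm (restrict_to T1 u) <= delta * l2norm w + (1 + eps) * l2norm e.
  have -> : restrict_to T1 u = restrict_to T1 (u - w).
    rewrite restrictB (restrict_off_estimate _ T1I).
    have -> : restrict_to T1 v = 0; last by rewrite subr0.
    apply/colP => i; rewrite restrict_toE mxE; case: ifP => // /setDP[_].
    by rewrite inE negbK => /eqP.
  apply/observation_error/small/(leq_trans _ leJ)/subset_leq_card.
  exact: subset_trans (subsetDl _ _) J0J.
have missed : l2norm (restrict_to (~: I) v) <=
    l2norm (restrict_to J u) + (delta * l2norm w + (1 + eps) * l2norm e).
  have -> : restrict_to (~: I) v = restrict_to T0 v.
    apply/colP => i; rewrite !restrict_toE !inE.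
    by case: (i \in I) => //=; case: eqP.
  have leT0 : (#|T0| <= m)%N.
    by apply: leq_trans v_sparse; rewrite subset_leq_card ?subsetDl.
  rewrite -(restrict_off_estimate _ T0I).
  have -> : restrict_to T0 w = restrict_to T0 u - restrict_to T0 (u - w).
    by rewrite (restrictB T0 u) subKr.
  apply: le_trans (ler_l2normD _ _) _; rewrite l2normN lerD //.
    exact: biggest_coords_energy bigJ leT0.
  exact/observation_error/small.
have energy : l2norm (restrict_to J u) <= 5 * q * l2norm (restrict_to T1 u).
  have := comparable_energy cJ0 le_wrong; have := regularize_energy m_ge4 leJ regJ0.
  have ln_ge0 : 0 <= ln (m%:R : R) by have := @ln_nat_ge1 R m m_ge4; lra.
  rewrite -/T1 => le_J le_J0; apply: ler_of_sqr_scaled; rewrite ?l2norm_ge0 //.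
    by have := sqrt_ln_ge1; lra.
  have q2 : q ^+ 2 = ln m%:R by rewrite sqr_sqrtr.
  rewrite [(5 * q) ^+ 2]exprMn q2; apply: (le_trans le_J).
  have : 4 * ln m%:R * l2norm (restrict_to J0 u) ^+ 2 <=
         4 * ln m%:R * (5 * l2norm (restrict_to T1 u) ^+ 2).
    by apply: ler_wpM2l le_J0; apply: mulr_ge0.
  have : 0 <= ln m%:R * l2norm (restrict_to T1 u) ^+ 2 by rewrite mulr_ge0 ?sqr_ge0.
  by move=> h1 h2; nra.
have leI3 : (#|I| <= 3 * m)%N by apply: leq_trans leI _; rewrite leq_mul2r orbT.
have := estimate_error leI3.
have [d_ge0 d_le dq_le] := delta_bounds.
have := RIC_eps_le; have := sqrt_ln_ge1; have := l2norm_ge0 w; have := l2norm_ge0 e.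
have := l2norm_ge0 (restrict_to (~: I) v).
move: (l2norm w) (l2norm e) (l2norm (restrict_to (~: I) v)) noise missed energy
  => nw ne nv noise missed energy nv_ge0 ne_ge0 nw_ge0 q1 eps1 est.
(* Here 6 = 1 + 5, as q >= 1. *)
have le_v : nv <= 6 * (q * (delta * nw + (1 + eps) * ne)) by nra.
have le_dw : delta * q * nw <= 31 / 1000 * nw by apply: ler_wpM2r.
have le_qe : (1 + eps) * (q * ne) <= 1015 / 1000 * (q * ne).
  by apply: ler_wpM2r; [rewrite mulr_ge0 //|]; lra.
have le_e : ne <= q * ne by rewrite ler_peMl.
have le_ee : (1 + eps) * ne <= 1015 / 1000 * ne by apply: ler_wpM2r; lra.
have le_d : delta * nw <= 31 / 1000 * nw by apply: ler_wpM2r.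
lra.
Qed.
End Estimate.

(** As long as a noticeable part of [v] is missed, each round captures a new
    coordinate of [supp v], and at least half of those selected so far lie in
    [supp v]; hence [supp v] is exhausted at the end. *)
Lemma romp_invariant {k : nat} {s : romp_state R N d} :
    romp_run Phi x m k s ->
  [/\ least_squares Phi x (romp_index s) (romp_estimate s),
      romp_residual s = x - Phi *m romp_estimate s,
      (#|romp_index s| <= 3 * m)%N &
      l2norm (restrict_to (~: romp_index s) v) <= 9 * q * l2norm e \/
      (k <= #|romp_index s :&: supp v|)%N /\
      (#|romp_index s| <= 2 * #|romp_index s :&: supp v|)%N].
Proof.
elim=> {k s} [|k s s' _ [ls res leI progress] _ ltI [J [J0 [bigJ regJ0 eqI ls' res']]]].
  split=> /=; rewrite ?mulmx0 ?subr0 ?cards0 //; last by right.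
  split; first by apply/suppP => i _; rewrite mxE.
  by move=> z /restrict_id <-; rewrite restrict0.
have [J0J _ _] := regJ0; have [Ju cardJ _] := bigJ.
have leJ0 : (#|J0| <= m)%N.
  by rewrite (leq_trans (subset_leq_card J0J)) // cardJ geq_minl.
rewrite res in bigJ regJ0 Ju.
have J0I : romp_index s :&: J0 = set0.
  apply/eqP; rewrite setI_eq0 disjoint_sym disjoints_subset.
  apply/subsetP => i /(subsetP J0J)/(subsetP Ju); rewrite !inE.
  by apply: contraNN => iI; rewrite (least_squares_orthogonal i ls).
split=> //.
  rewrite eqI (leq_trans (leq_card_setU _ _).1) //.
  by rewrite (mulnDl 2 1) mul1n leq_add // ltnW.
have mono : l2norm (restrict_to (~: romp_index s') v) <=
            l2norm (restrict_to (~: romp_index s) v).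
  by apply: l2norm_restrict_sub; rewrite eqI setCS subsetUl.
case: progress => [done|[prog_k prog_I]]; first by left; apply: le_trans done.
have [wrong|right] := leqP #|J0 :&: supp v| #|J0 :\: supp v|.
  by left; apply: le_trans mono _; apply: wrong_selection_error ls _ _ _ bigJ regJ0 wrong; lia.
right; rewrite eqI setIUl.
have -> : #|romp_index s :|: J0| = (#|romp_index s| + #|J0|)%N.
  by rewrite cardsU J0I cards0 subn0.
have -> : #|(romp_index s :&: supp v) :|: (J0 :&: supp v)| =
    (#|romp_index s :&: supp v| + #|J0 :&: supp v|)%N.
  by rewrite cardsU setIACA J0I set0I cards0 subn0.
have := cardsID (supp v) J0.
move: #|J0 :&: _| #|J0 :\: _| #|romp_index s :&: _| #|J0| #|romp_index s|
  prog_k prog_I right => {ltI leI leJ0 cardJ} a b c j i; lia.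
Qed.

Lemma romp_stability {I : {set 'I_d}} {y : 'cV[R]_d} :
  romp_output Phi x m I y -> l2norm (y - v) <= 11 * q * l2norm e.
Proof.
move=> [k [s [run halt _ ->]]] {I y}.
have [ls _ leI progress] := romp_invariant run.
have qe_ge : l2norm e <= q * l2norm e by rewrite ler_peMl ?l2norm_ge0 // sqrt_ln_ge1.
have missed : l2norm (restrict_to (~: romp_index s) v) <= 9 * q * l2norm e.
  case: progress => // -[prog_k prog_I].
  have leS : (#|supp v| <= #|romp_index s :&: supp v|)%N.
    by apply: leq_trans v_sparse _; case: halt prog_k prog_I => [->|]; lia.
  have subS : supp v \subset romp_index s.
    by apply/setIidPr/eqP; rewrite eqEcard subsetIr.
  have -> : restrict_to (~: romp_index s) v = 0.
    apply/colP => i; rewrite restrict_toE mxE inE; case: ifP => // /negP iI.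
    by have /suppP := subS; apply; apply/negP.
  by rewrite l2norm0 !mulr_ge0 ?l2norm_ge0 //; have := sqrt_ln_ge1; lra.
rewrite -l2normN opprB.
have := estimate_error ls leI; have [_ delta_le _] := delta_bounds.
have := RIC_eps_le; have := l2norm_ge0 e; have := l2norm_ge0 (v - romp_estimate s).
move: (l2norm e) (l2norm (v - romp_estimate s)) qe_ge missed => ne nw qe_ge missed nw_ge0 ne_ge0 leps est.
have : (1 + eps) * ne <= 1015 / 1000 * ne by apply: ler_wpM2r; lra.
have : delta * nw <= 31 / 1000 * nw by apply: ler_wpM2r.
lra.
Qed.

End Stability.

(** * From sparse to arbitrary vectors *)

(** Take for [a] the biggest magnitude outside [S2]. The coordinates in
    [S2 :\: S] are at least [a] in magnitude, and they outnumber by at least [n]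
    those in [S :\: S2], which are at most [a]. Exchanging the two groups turns
    [l1norm (restrict_to (~: S2) v)] into [l1norm (v - restrict_to S v)] and
    leaves a surplus of [n] coordinates. *)
Lemma l1_tail {R : realType} {d n : nat} {v : 'cV[R]_d} {S S2 : {set 'I_d}} :
    (#|S| <= n)%N -> biggest_coords (2 * n) [set: 'I_d] v S2 ->
  exists2 a : R, 0 <= a /\ (forall i, i \notin S2 -> `|v i 0| <= a) &
    n%:R * a + l1norm (restrict_to (~: S2) v) <= l1norm (v - restrict_to S v).
Proof.
move=> leS [_ cardS2 maxS2].
rewrite /l1norm.
under eq_bigr => i _ do rewrite restrict_toE inE (fun_if Num.norm) normr0.
rewrite -big_mkcond /=.
have -> : \sum_(i < d) `|(v - restrict_to S v) i 0| = \sum_(i in ~: S) `|v i 0|.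
  rewrite [RHS]big_mkcond; apply: eq_bigr => i _; rewrite !mxE inE.
  by case: ifP => _ /=; rewrite ?subrr ?normr0 ?subr0.
have [full|[i0 i0S2]] := set_0Vmem (~: S2).
  have allS2 i : i \in S2 by rewrite -[S2]setCK full in_setC in_set0.
  exists 0; first by split=> // i; rewrite allS2.
  rewrite mulr0 add0r big1 ?sumr_ge0 // => i.
  by rewrite allS2.
case: (arg_maxP (fun i => `|v i 0|) i0S2) => i1 i1S2 max_i1.
exists `|v i1 0|; first by split=> // i; rewrite -in_setC; apply: max_i1.
have i1nS2 : i1 \notin S2 by rewrite -in_setC.
have cardS2' : #|S2| = (2 * n)%N.
  have : (#|S2| < d)%N.
    rewrite -[X in (_ < X)%N]card_ord -cardsT proper_card // properE subsetT /=.
    by apply/subsetPn; exists i1.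
  by rewrite cardS2 cardsT card_ord; lia.
have -> : \sum_(i in ~: S) `|v i 0| =
    \sum_(i in ~: S :&: S2) `|v i 0| + \sum_(i in ~: S2 :\: S) `|v i 0|.
  by rewrite (big_setID S2) /= !setDE (setIC (~: S2)).
have -> : \sum_(i | i \notin S2) `|v i 0| =
    \sum_(i in S :&: ~: S2) `|v i 0| + \sum_(i in ~: S2 :\: S) `|v i 0|.
  rewrite setIC -(big_setID S (fun i => `|v i 0|)); apply: eq_bigl => i.
  by rewrite in_setC.
have : \sum_(i in S :&: ~: S2) `|v i 0| <= #|S :&: ~: S2|%:R * `|v i1 0|.
  rewrite mulr_natl -sumr_const; apply: ler_sum => i /setIP[_ iS2].
  exact: max_i1.
have : #|~: S :&: S2|%:R * `|v i1 0| <= \sum_(i in ~: S :&: S2) `|v i 0|.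
  rewrite mulr_natl -sumr_const; apply: ler_sum => i /setIP[_ iS2].
  by apply: maxS2; rewrite ?inE ?i1nS2.
have : (n + #|S :&: ~: S2|)%:R * `|v i1 0| <= #|~: S :&: S2|%:R * `|v i1 0|.
  apply: ler_wpM2r => //; rewrite ler_nat.
  have := cardsID S2 S; have := cardsID S S2.
  rewrite !setDE [S2 :&: S]setIC [S2 :&: ~: S]setIC.
  move: cardS2' leS; move: #|S| #|S2| #|S :&: S2| #|_ :&: _| #|_ :&: _| => a b c x y; lia.
rewrite natrD mulrDl; lra.
Qed.

(* ROMP is run with sparsity level 2n, the level of the target v_{2n}. *)
Theorem corollary1p3 (R : realType) (N d n : nat) (Phi : 'M[R]_(N, d))
    (n_gt0 : (0 < n)%N)
    (Phi_RIC : RIC Phi (8 * n) ((1 / 100) / Num.sqrt (ln n%:R)))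
    (v : 'cV[R]_d) (e : 'cV[R]_N)
    (v_n v_2n : 'cV[R]_d)
    (v_nP : biggest_part n v v_n)
    (v_2nP : biggest_part (2 * n) v v_2n)
    (I : {set 'I_d}) (vhat : 'cV[R]_d)
    (vhatP : romp_output Phi (Phi *m v + e) (2 * n) I vhat) :
  l2norm (vhat - v_2n) <=
    159 * Num.sqrt (ln (2 * n)%:R) *
      (l2norm e + l1norm (v - v_n) / Num.sqrt n%:R).
Proof.
have [/andP[eps_gt0 _] _] := Phi_RIC.
(* The positivity of the isometry constant excludes n = 1, where it is 1 / 0. *)
have n_gt1 : (1 < n)%N.
  rewrite ltn_neqAle n_gt0 andbT; apply: contraTneq eps_gt0 => <-.
  by rewrite ln1 sqrtr0 invr0 mulr0 ltxx.
have m_ge4 : (4 <= 2 * n)%N by lia.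
move: Phi_RIC eps_gt0; set eps := _ / _ => Phi_RIC eps_gt0.
set q := Num.sqrt (ln (2 * n)%:R).
have q1 : 1 <= q by apply: sqrt_ln_ge1.
have ln_gt0 : 0 < ln (n%:R : R).
  by rewrite -[X in X < _]ln1 ltr_ln ?posrE ?ltr0n // ltr1n.
have eps_q : eps * q <= 15 / 1000.
  pose p := Num.sqrt (ln (n%:R : R)).
  have p_gt0 : 0 < p by rewrite sqrtr_gt0.
  (* 2n <= n ^+ 2, so ln (2n) <= 2 ln n; and 3 / 2 exceeds sqrt 2. *)
  have le_q : q <= 3 / 2 * p.
    have q2 : q ^+ 2 = ln (2 * n)%:R.
      by rewrite sqr_sqrtr //; have := @ln_nat_ge1 R _ m_ge4; lra.
    have p2 : p ^+ 2 = ln n%:R by rewrite sqr_sqrtr // ltW.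
    have : ln ((2 * n)%:R : R) <= ln (n%:R ^+ 2).
      rewrite ler_ln ?posrE ?exprn_gt0 ?ltr0n ?muln_gt0 ?n_gt0 // -natrX ler_nat.
      by rewrite expnS expn1 leq_mul2r n_gt1 orbT.
    rewrite expr2 lnM ?posrE ?ltr0n // -q2 -p2 => le_q2.
    rewrite -ler_sqr ?nnegrE //; [nra | lra | nra].
  have -> : 15 / 1000 = eps * (3 / 2 * p) :> R.
    by rewrite /eps -/p; field; rewrite gt_eqF.
  by rewrite ler_pM2l.
have [S2 bigS2 def_v2n] := v_2nP.
have [S [_ cardS _] def_vn] := v_nP.
have leS : (#|S| <= n)%N by rewrite cardS geq_minl.
have [a [a_ge0 le_a]] := l1_tail leS bigS2; rewrite -def_vn => le_l1.
pose h := restrict_to (~: S2) v.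
have v2n_sparse : sparse (2 * n) v_2n.
  rewrite /sparse def_v2n (leq_trans (subset_leq_card (supp_restrict S2 v))) //.
  by case: bigS2 => _ -> _; rewrite geq_minl.
(* The part of v outside v_2n is treated as additional noise. *)
rewrite (restrict_split S2 v) -def_v2n -/h mulmxDr -addrA in vhatP.
have RIC4 : RIC Phi (4 * (2 * n)) eps by rewrite mulnA.
have stable := romp_stability m_ge4 RIC4 eps_q v2n_sparse vhatP.
have tail : l2norm (Phi *m h) <= (1 + eps) * ((n%:R * a + l1norm h) / Num.sqrt n%:R).
  apply: (RIC_tail Phi_RIC); rewrite ?n_gt0 //; first by lia.
  move=> i; rewrite restrict_toE inE; case: ifP => [/le_a//|_].
  by rewrite normr0.
set K := l1norm (v - v_n) / _.
have q_gt0 : 0 < Num.sqrt n%:R :> R by rewrite sqrtr_gt0 ltr0n.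
have K_ge : (n%:R * a + l1norm h) / Num.sqrt n%:R <= K.
  by apply: ler_wpM2r le_l1; rewrite invr_ge0 ltW.
have K_ge0 : 0 <= K.
  by apply: divr_ge0; [apply: sumr_ge0 | apply: ltW].
have RIC_eps_le := @RIC_eps_le _ _ _ _ _ _ m_ge4 RIC4 eps_q.
have tailK : l2norm (Phi *m h) <= 2 * K.
  apply: (le_trans tail); apply: (@le_trans _ _ ((1 + eps) * K)).
    by apply: ler_wpM2l K_ge; lra.
  by apply: ler_wpM2r => //; lra.
rewrite -/q in stable; apply: (le_trans stable).
have noise : l2norm (Phi *m h + e) <= 2 * (l2norm e + K).
  by have := ler_l2normD (Phi *m h) e; have := l2norm_ge0 e; lra.
have noise_ge0 : 0 <= q * (l2norm e + K).
  by rewrite mulr_ge0 ?addr_ge0 ?l2norm_ge0 //; lra.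
apply: (@le_trans _ _ (11 * q * (2 * (l2norm e + K)))).
  by apply: ler_wpM2l noise; lra.
move: noise_ge0; lra.
Qed.
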